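(* Let $\Phi$ be a finite crystallographic root system in a real vector space $V$ of dimension $n$ with simple roots $\alpha_1,\dots,\alpha_n$, Weyl group $W$, and a bipartition $I=I_+\sqcup I_-$ of its Dynkin diagram, with signs $\varepsilon(i)$. Let $L:V\to V$ be the linear map with $L(\alpha_i)=\varepsilon(i)\omega_i$ for all $i$. Then the image under $L$ of the cluster fan of $\Phi$ is a fan that is refined by the normal fan of the $W$-permutohedron; that is, every cone of the image fan is a union of cones of the Coxeter fan of $W$ in $V$.
   Context: Fix a $W$-invariant inner product $\langle\cdot,\cdot\rangle$ on $V$. Coroots are $\alpha^\vee=2\alpha/\langle\alpha,\alpha\rangle$; the fundamental weights $\omega_j$ are defined by $\langle\alpha_i^\vee,\omega_j\rangle=\delta_{ij}$. A bipartition $I_+\sqcup I_-$ of the index set $I=\{1,\dots,n\}$ means each $I_\pm$ contains no two adjacent vertices of the Dynkin diagram; $\varepsilon(i)=+1$ if $i\in I_+$ and $-1$ if $i\in I_-$. Let $\Phi_{\ge-1}$ be the set of positive roots together with the negative simple roots $-\alpha_i$. For $\varepsilon\in\{+,-\}$ define $\tau_\varepsilon:\Phi_{\ge-1}\to\Phi_{\ge-1}$ by $\tau_\varepsilon(\alpha)=\alpha$ if $\alpha=-\alpha_i$ with $i\in I_{-\varepsilon}$, and $\tau_\varepsilon(\alpha)=\big(\prod_{i\in I_\varepsilon}s_i\big)(\alpha)$ otherwise, where $s_i$ is the simple reflection for $\alpha_i$. Compatibility is the unique symmetric relation on $\Phi_{\ge-1}$ such that $-\alpha_i$ is compatible with $\beta$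 iff the coefficient of $\alpha_i$ in $\beta$ (in the basis of simple roots) is $0$, and $\beta,\theta$ are compatible iff $\tau_\varepsilon\beta,\tau_\varepsilon\theta$ are compatible for $\varepsilon=\pm$. A cluster is a maximal set of pairwise compatible elements of $\Phi_{\ge-1}$; clusters are bases of $V$, and the cones spanned by subsets of clusters form a complete simplicial fan, the cluster fan. The Coxeter fan of $W$ in $V$ is the fan formed by the closures of the connected components of the complement of the hyperplanes orthogonal to the roots, together with their faces; it is the normal fan of the $W$-permutohedron. *)

(* Defs.v *)
From mathcomp Require Import all_boot all_order all_algebra.
Set Implicit Arguments. Unset Strict Implicit. Unset Printing Implicit Defensive.
Import Order.TTheory GRing.Theory Num.Theory.
Local Open Scope ring_scope.

Section Defs.
Variables (R : realFieldType) (n : nat).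
Notation V := 'rV[R]_n.

Definition ip (B : 'M[R]_n) (u v : V) : R := (u *m B *m v^T) 0 0.

Definition inner_product (B : 'M[R]_n) : Prop :=
  B^T = B /\ forall v : V, v != 0 -> 0 < ip B v v.

Definition copair (B : 'M[R]_n) (a x : V) : R := 2 * ip B a x / ip B a a.

Definition refl (B : 'M[R]_n) (a x : V) : V := x - copair B a x *: a.

Definition root_system (B : 'M[R]_n) (Phi : seq V) : Prop :=
  [/\ 0 \notin Phi,
      (forall v : V, exists c : 'I_(size Phi) -> R,
          v = \sum_(k < size Phi) c k *: Phi`_k),
      (forall a b, a \in Phi -> b \in Phi -> refl B a b \in Phi),
      (forall a b, a \in Phi -> b \in Phi -> exists z : int, copair B a b = z%:~R)
    & (forall a (c : R), a \in Phi -> c *: a \in Phi -> c = 1 \/ c = -1)].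

Definition simple_roots (Phi : seq V) (alpha : 'I_n -> V) : Prop :=
  [/\ (forall i, alpha i \in Phi),
      (forall c : 'I_n -> R, \sum_i c i *: alpha i = 0 -> forall i, c i = 0)
    & (forall b, b \in Phi -> exists c : 'I_n -> int,
          b = \sum_i (c i)%:~R *: alpha i /\
          ((forall i, (0 <= c i)%R) \/ (forall i, (c i <= 0)%R)))].

Definition positive_root (Phi : seq V) (alpha : 'I_n -> V) (b : V) : Prop :=
  b \in Phi /\ exists c : 'I_n -> R, (forall i, 0 <= c i) /\ b = \sum_i c i *: alpha i.

Definition almost_pos (Phi : seq V) (alpha : 'I_n -> V) (b : V) : Prop :=
  positive_root Phi alpha b \/ exists i, b = - alpha i.

Definition coef_zero (alpha : 'I_n -> V) (i : 'I_n) (b : V) : Prop :=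
  exists c : 'I_n -> R, b = \sum_j c j *: alpha j /\ c i = 0.

(* Bipartition: Iplus is I_+, its complement is I_-; no two adjacent
   vertices (i <> j with <alpha_i, alpha_j> <> 0) lie in the same part. *)
Definition bipartition (B : 'M[R]_n) (alpha : 'I_n -> V) (Iplus : {set 'I_n}) : Prop :=
  forall i j, i != j -> ip B (alpha i) (alpha j) != 0 -> (i \in Iplus) != (j \in Iplus).

Definition eps (Iplus : {set 'I_n}) (i : 'I_n) : R := if i \in Iplus then 1 else -1.

Definition Ipart (Iplus : {set 'I_n}) (e : bool) : {set 'I_n} :=
  if e then Iplus else ~: Iplus.

Definition prod_refl (B : 'M[R]_n) (alpha : 'I_n -> V) (Iplus : {set 'I_n})
  (e : bool) (x : V) : V :=
  foldr (fun i y => refl B (alpha i) y) x (enum (Ipart Iplus e)).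

Definition tau (B : 'M[R]_n) (alpha : 'I_n -> V) (Iplus : {set 'I_n})
  (e : bool) (x : V) : V :=
  if [exists i, (x == - alpha i) && (i \in Ipart Iplus (~~ e))] then x
  else prod_refl B alpha Iplus e x.

Definition compatibility (B : 'M[R]_n) (Phi : seq V) (alpha : 'I_n -> V)
  (Iplus : {set 'I_n}) (comp : V -> V -> Prop) : Prop :=
  [/\ (forall b t, almost_pos Phi alpha b -> almost_pos Phi alpha t ->
         comp b t <-> comp t b),
      (forall i b, almost_pos Phi alpha b ->
         comp (- alpha i) b <-> coef_zero alpha i b)
    & (forall b t, almost_pos Phi alpha b -> almost_pos Phi alpha t ->
         forall e, comp b t <-> comp (tau B alpha Iplus e b) (tau B alpha Iplus e t))].

Definition cluster (Phi : seq V) (alpha : 'I_n -> V) (comp : V -> V -> Prop)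
  (C : seq V) : Prop :=
  [/\ (forall x, x \in C -> almost_pos Phi alpha x),
      (forall x y, x \in C -> y \in C -> x != y -> comp x y)
    & (forall z, almost_pos Phi alpha z ->
         (forall x, x \in C -> z != x -> comp z x) -> z \in C)].

Definition cone (S : seq V) (x : V) : Prop :=
  exists l : 'I_(size S) -> R, (forall k, 0 <= l k) /\ x = \sum_(k < size S) l k *: S`_k.

(* the closed cone of the Coxeter fan having x0 in its relative interior:
   the face of the hyperplane arrangement {<beta,.> = 0 | beta in Phi}
   cut out by the sign vector of x0 *)
Definition cox_cone (B : 'M[R]_n) (Phi : seq V) (x0 x : V) : Prop :=
  forall b, b \in Phi ->
    (0 < ip B b x0 -> 0 <= ip B b x) /\ (ip B b x0 = 0 -> ip B b x = 0).

End Defs.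

(* Main.v *)
(* Write L for the linear map and pair x, y by <x, L y> = sum_i eps(i) d_i x_i y_i,
   where d_i = <alpha_i, alpha_i> / 2 and x_i, y_i are coordinates on simple roots.
   The products t_+ and t_- of the simple reflections over I_+ and I_- are adjoint
   up to sign: <x, L t_+ y> = - <t_- x, L y>. Hence tau_+ and tau_- carry a basis of
   V whose dual basis consists of multiples of roots to a basis of the same kind,
   even at the negative simple roots that tau fixes, because the other members of
   a cluster have zero coordinate there. Some composite of tau_+ and tau_- moves a
   given cluster to one containing some -alpha_i; removing it leaves a cluster of
   the parabolic subsystem without alpha_i, so by induction on the rank every
   cluster is a basis dual to multiples of roots. The image cone and its faces are
   thus cut out by signs of roots, and contain the smallest Coxeter cone of each
   of their points. The restriction to parabolic subsystems is legitimate since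
   compatibility is expressed by signs of the pairing. *)
Require Import Defs.
From HB Require Import structures.
From mathcomp Require Import all_boot all_order all_algebra.
From mathcomp Require Import ring lra.
Import Order.TTheory GRing.Theory Num.Theory.
Local Open Scope ring_scope.
Set Implicit Arguments. Unset Strict Implicit. Unset Printing Implicit Defensive.

(** * Linearity of the form, simple coordinates, coroots and reflection products *)

Fact ip_is_scalar (R : realFieldType) n (B : 'M[R]_n) u : scalar (ip B u).
Proof.
by move=> a x y; rewrite /ip linearD linearZ mulmxDr -scalemxAr !mxE.
Qed.
HB.instance Definition _ (R : realFieldType) n (B : 'M[R]_n) u :=
  GRing.isLinear.Build R 'rV[R]_n R *%R (ip B u) (@ip_is_scalar R n B u).

Definition simple_coord (R : realFieldType) n (alpha : 'I_n -> 'rV[R]_n) i (x : 'rV[R]_n) :=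
  (x *m invmx (\matrix_j alpha j)) 0 i.

Fact simple_coord_is_scalar (R : realFieldType) n (alpha : 'I_n -> 'rV[R]_n) i :
  scalar (simple_coord alpha i).
Proof. by move=> a x y; rewrite /simple_coord mulmxDl -scalemxAl !mxE. Qed.
HB.instance Definition _ (R : realFieldType) n (alpha : 'I_n -> 'rV[R]_n) i :=
  GRing.isLinear.Build R 'rV[R]_n R *%R (simple_coord alpha i) (@simple_coord_is_scalar R n alpha i).

Fact copair_is_scalar (R : realFieldType) n (B : 'M[R]_n) a : scalar (copair B a).
Proof. by move=> c x y; rewrite /copair linearP /=; ring. Qed.
HB.instance Definition _ (R : realFieldType) n (B : 'M[R]_n) a :=
  GRing.isLinear.Build R 'rV[R]_n R *%R (copair B a) (@copair_is_scalar R n B a).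

(** Closed form of the product of the reflections over [K], correct when the simple roots in [K] are
    mutually orthogonal; linearity and coordinates can then be read off. *)
Definition prod_refls (R : realFieldType) n (B : 'M[R]_n) (alpha : 'I_n -> 'rV[R]_n)
  (K : {set 'I_n}) (x : 'rV[R]_n) := x - \sum_(i in K) copair B (alpha i) x *: alpha i.

Fact prod_refls_is_linear (R : realFieldType) n (B : 'M[R]_n) (alpha : 'I_n -> 'rV[R]_n) K :
  linear (prod_refls B alpha K).
Proof.
move=> c x y; rewrite /prod_refls scalerBr addrACA -opprD scaler_sumr -big_split /=.
by congr (_ - _); apply: eq_bigr => i _; rewrite linearP scalerDl scalerA.
Qed.
HB.instance Definition _ (R : realFieldType) n (B : 'M[R]_n) (alpha : 'I_n -> 'rV[R]_n) K :=
  GRing.isLinear.Build R 'rV[R]_n 'rV[R]_n *:%R (prod_refls B alpha K) (@prod_refls_is_linear R n B alpha K).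

Section ClusterFan.

Variables (R : realFieldType) (n : nat) (B : 'M[R]_n).
Variables (Phi : seq 'rV[R]_n) (alpha : 'I_n -> 'rV[R]_n) (Iplus : {set 'I_n}).
Variables (omega : 'I_n -> 'rV[R]_n) (M : 'M[R]_n).
Hypotheses (ipB : inner_product B) (rootPhi : root_system B Phi).
Hypotheses (simplePhi : simple_roots Phi alpha) (bipI : bipartition B alpha Iplus).
Hypothesis omegaP : forall i j, copair B (alpha i) (omega j) = (i == j)%:R.
Hypothesis actM : forall i, alpha i *m M = eps R Iplus i *: omega i.

Notation V := 'rV[R]_n.
Notation "''[' u , v ]" := (ip B u v) : ring_scope.
Notation refls := (prod_refls B alpha).
Notation Ip := (Ipart Iplus).
Notation co := (simple_coord alpha).
Implicit Types (i j : 'I_n) (J K : {set 'I_n}) (e : bool) (x y z u v w : V).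

(** * The inner product and coordinates on the simple roots *)

Lemma ipC u v : '[u, v] = '[v, u].
Proof.
have -> : '[v, u] = (v *m B *m u^T)^T 0 0 by rewrite mxE.
by rewrite !trmx_mul trmxK ipB.1 mulmxA.
Qed.

Lemma ip_suml I (s : seq I) (P : pred I) F v :
  '[\sum_(i <- s | P i) F i, v] = \sum_(i <- s | P i) '[F i, v].
Proof. by rewrite ipC raddf_sum; apply: eq_bigr => i _; apply: ipC. Qed.

Lemma ip_eq0 v : ('[v, v] == 0) = (v == 0).
Proof.
apply/eqP/eqP => [v0|->]; last by rewrite raddf0.
by apply: contra_eq v0 => /ipB.2/gt_eqF ->.
Qed.

Lemma ip_gt0 v : v != 0 -> 0 < '[v, v].
Proof. exact: ipB.2. Qed.

Lemma alpha_root i : alpha i \in Phi.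
Proof. by case: simplePhi. Qed.

Lemma root_neq0 b : b \in Phi -> b != 0.
Proof. by case: rootPhi => Phi0 _ _ _ _ bPhi; apply: contraNneq Phi0 => <-. Qed.

Lemma alpha_neq0 i : alpha i != 0.
Proof. exact: root_neq0 (alpha_root i). Qed.

Lemma alpha_unit : (\matrix_j alpha j) \in unitmx.
Proof.
rewrite -row_free_unit -kermx_eq0; apply/eqP/row_matrixP => i.
have := row_sub i (kermx (\matrix_j alpha j)); move/sub_kermxP.
move: (row i _) => r; rewrite mulmx_sum_row row0.
under eq_bigr do rewrite rowK.
by case: simplePhi => _ fr _ /fr r0; apply/rowP => j; rewrite r0 mxE.
Qed.

Lemma coE x : x = \sum_i co i x *: alpha i.
Proof.
rewrite -{1}[x](mulmxKV alpha_unit) mulmx_sum_row.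
by apply: eq_bigr => i _; rewrite rowK.
Qed.

Lemma co_inj x y : (forall i, co i x = co i y) -> x = y.
Proof. by move=> h; rewrite [x]coE [y]coE; apply: eq_bigr => i _; rewrite h. Qed.

Lemma co_alpha i j : co i (alpha j) = (i == j)%:R.
Proof.
have -> : alpha j = row j 1%:M *m (\matrix_k alpha k).
  by rewrite -row_mul mul1mx rowK.
by rewrite /simple_coord mulmxK ?alpha_unit // !mxE eq_sym.
Qed.

Lemma co_sum (c : 'I_n -> R) i : co i (\sum_j c j *: alpha j) = c i.
Proof.
rewrite raddf_sum (bigD1 i) //= linearZ /= co_alpha eqxx mulr1 big1 ?addr0 //.
by move=> j ji; rewrite linearZ /= co_alpha eq_sym (negPf ji) mulr0.
Qed.

Lemma alpha_inj : injective alpha.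
Proof.
move=> i j /(congr1 (co i)); rewrite !co_alpha eqxx.
by case: eqP => // _ /eqP; rewrite oner_eq0.
Qed.

(** * The pairing through [M], diagonal in simple coordinates *)

Definition half_sqnorm i : R := '[alpha i, alpha i] / 2.

Lemma half_sqnorm_gt0 i : 0 < half_sqnorm i.
Proof. by rewrite divr_gt0 ?ip_gt0 ?alpha_neq0. Qed.

Lemma copairE i x : copair B (alpha i) x = '[alpha i, x] / half_sqnorm i.
Proof.
have := ip_gt0 (alpha_neq0 i); rewrite /copair /half_sqnorm => h.
by field; rewrite gt_eqF.
Qed.

(* The pairing of Fomin and Zelevinsky: one argument stands for a root of the
   Coxeter arrangement, the other for a point of the cluster fan. *)
Notation pr x y := ('[x, y *m M]).

(** Being dual to the coroots, [omega j] is orthogonal to every simple root but [alpha j], so no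
    mixed terms survive. *)
Lemma prE x y : pr x y = \sum_i eps R Iplus i * half_sqnorm i * co i x * co i y.
Proof.
rewrite {1}[x]coE ip_suml; apply: eq_bigr => i _.
rewrite ipC linearZ /= ipC {1}[y]coE mulmx_suml raddf_sum (bigD1 i) //=.
have ao j : '[alpha i, omega j] = (i == j)%:R * half_sqnorm i.
  by rewrite -omegaP copairE divfK // gt_eqF ?half_sqnorm_gt0.
rewrite big1 => [|j ji]; rewrite -scalemxAl actM !linearZ /= ao.
  by rewrite eqxx mul1r addr0; ring.
by rewrite eq_sym (negPf ji) mul0r !mulr0.
Qed.

Lemma prC x y : pr x y = pr y x.
Proof. by rewrite !prE; apply: eq_bigr => i _; ring. Qed.

Lemma pr_alpha i x : pr (alpha i) x = eps R Iplus i * half_sqnorm i * co i x.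
Proof.
rewrite prE (bigD1 i) //= co_alpha eqxx mulr1 big1 ?addr0 // => j ji.
by rewrite co_alpha (negPf ji) mulr0 mul0r.
Qed.

Lemma eps_neq0 i : eps R Iplus i != 0.
Proof. by rewrite /eps; case: ifP => _; rewrite ?oppr_eq0 oner_eq0. Qed.

Lemma prN x y : pr x (- y) = - pr x y.
Proof. by rewrite mulNmx raddfN. Qed.
Lemma prNl x y : pr (- x) y = - pr x y.
Proof. by rewrite prC prN prC. Qed.


(** * Products of reflections over one half of the Dynkin diagram *)

Lemma co_refls K j x :
  co j (refls K x) = co j x - (j \in K)%:R * copair B (alpha j) x.
Proof.
rewrite raddfB raddf_sum big_mkcond (bigD1 j) //= big1 => [|i ij].
  by case: ifP => jK; rewrite ?linearZ /= ?co_alpha ?eqxx ?mulr1 ?mul1r ?mul0r addr0.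
by case: ifP => // _; rewrite linearZ /= co_alpha eq_sym (negPf ij) mulr0.
Qed.

Lemma co_refls_out K j x : j \notin K -> co j (refls K x) = co j x.
Proof. by move=> jK; rewrite co_refls (negPf jK) mul0r subr0. Qed.

Lemma part_ortho e i j :
  i \in Ip e -> j \in Ip e -> i != j -> '[alpha i, alpha j] = 0.
Proof.
move=> iI jI /bipI ij; apply/eqP; apply: contraT => /ij.
by case: e iI jI => /=; [move=> -> ->|rewrite !inE => /negPf -> /negPf ->].
Qed.

Lemma copair_self i : copair B (alpha i) (alpha i) = 2.
Proof. by rewrite /copair mulfK // gt_eqF ?ip_gt0 ?alpha_neq0. Qed.

Lemma copair_sum e K (c : 'I_n -> R) i : K \subset Ip e -> i \in Ip e ->
  copair B (alpha i) (\sum_(j in K) c j *: alpha j) = (i \in K)%:R * (2 * c i).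
Proof.
move=> /subsetP KI iI; rewrite raddf_sum big_mkcond (bigD1 i) //= big1 => [|j ji].
  by case: ifP => _; rewrite ?linearZ /= ?copair_self ?mul0r ?mul1r addr0 // mulrC.
case: ifP => // /KI jI.
by rewrite linearZ /= copairE (part_ortho iI jI) 1?eq_sym // mul0r mulr0.
Qed.

Lemma copair_refls e K i x : K \subset Ip e -> i \in K ->
  copair B (alpha i) (refls K x) = - copair B (alpha i) x.
Proof.
move=> KI iK; rewrite /prod_refls raddfB /= (copair_sum _ KI) ?(subsetP KI) // iK mul1r; ring.
Qed.

Lemma reflsK e K : K \subset Ip e -> involutive (refls K).
Proof.
move=> KI x; apply: co_inj => j; rewrite !co_refls.
case jK: (j \in K); last by rewrite !mul0r !subr0.
by rewrite (copair_refls _ KI) // !mul1r; ring.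
Qed.

Lemma refls_foldr e s x : uniq s -> {subset s <= Ip e} ->
  foldr (fun i y => refl B (alpha i) y) x s =
  refls [set i in s] x.
Proof.
elim: s => [|i s IHs] /=; first by rewrite /prod_refls big_pred0 ?subr0 // => i; rewrite inE.
case/andP=> iNs us si; have iI : i \in Ip e by apply: si; rewrite mem_head.
have sI : {subset s <= Ip e} by move=> j js; apply: si; rewrite inE js orbT.
have SI : [set i in s] \subset Ip e by apply/subsetP => j; rewrite inE; apply: sI.
rewrite IHs // /refl /prod_refls raddfB /= (copair_sum _ SI) //= inE (negPf iNs) mul0r subr0.
apply: co_inj => j; rewrite raddfB /= linearZ /= co_alpha !co_refls !inE.
case: eqP => [->|_]; first by rewrite (negPf iNs) mul0r subr0 mulr1 mul1r.
by rewrite mulr0 subr0.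
Qed.

Lemma refl_root a b : a \in Phi -> b \in Phi -> refl B a b \in Phi.
Proof. by case: rootPhi => _ _ + _ _; apply. Qed.

Lemma opp_root b : b \in Phi -> - b \in Phi.
Proof.
move=> bP; have := refl_root bP bP; congr (_ \in Phi).
by rewrite /refl /copair mulfK ?ip_eq0 ?root_neq0 // scaler_nat mulr2n opprD addNKr.
Qed.

Lemma refls_enum e K x : K \subset Ip e ->
  foldr (fun i y => refl B (alpha i) y) x (enum K) = refls K x.
Proof.
move=> KI; rewrite (@refls_foldr e) ?enum_uniq // => [|i]; last first.
  by rewrite mem_enum; apply: (subsetP KI).
by congr prod_refls; apply/setP => i; rewrite inE mem_enum.
Qed.

Lemma refls_root e K b : K \subset Ip e -> b \in Phi -> refls K b \in Phi.
Proof.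
move=> KI bP; rewrite -(refls_enum _ KI).
by elim: (enum K) => //= i s IHs; apply: refl_root IHs; apply: alpha_root.
Qed.

(** * Adjointness of the two half Coxeter elements *)

Definition sg e : R := if e then 1 else -1.

Lemma sgN e : sg (~~ e) = - sg e.
Proof. by case: e; rewrite /= ?opprK. Qed.

Lemma sg_sqr e : sg e * sg e = 1.
Proof. by case: e; rewrite /= ?mulrNN mulr1. Qed.

Lemma eps_part e i : i \in Ip e -> eps R Iplus i = sg e.
Proof. by rewrite /eps; case: e => /=; [move=> ->|rewrite inE => /negPf ->]. Qed.

Lemma Ip_neg e i : (i \in Ip (~~ e)) = (i \notin Ip e).
Proof. by case: e; rewrite /= ?inE // negbK. Qed.

Definition supp J x := forall i, i \notin J -> co i x = 0.

Lemma sum_parts J e (F : 'I_n -> R) : (forall i, i \notin J -> F i = 0) ->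
  \sum_i F i = \sum_(i in J :&: Ip e) F i + \sum_(i in J :&: Ip (~~ e)) F i.
Proof.
move=> F0; rewrite [X in _ = X + _]big_mkcond [X in _ = _ + X]big_mkcond -big_split /=; apply: eq_bigr => i _.
rewrite !inE Ip_neg; case: (boolP (i \in J)) => [_|/F0 ->] /=; last by rewrite addr0.
by case: (i \in Ip e); rewrite ?addr0 ?add0r.
Qed.

Lemma ip_part J e i y : i \in Ip e -> supp J y -> i \in J ->
  '[alpha i, y] = 2 * half_sqnorm i * co i y +
    \sum_(j in J :&: Ip (~~ e)) co j y * '[alpha i, alpha j].
Proof.
move=> iI yJ iJ; rewrite {1}[y]coE raddf_sum /=.
rewrite (@sum_parts J e) => [|j jJ]; last by rewrite yJ // scale0r raddf0.
congr (_ + _); last by apply: eq_bigr => j _; rewrite linearZ.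
rewrite (bigD1 i) ?inE ?iJ //= big1 => [|j].
  by rewrite linearZ /= /half_sqnorm addr0; field.
by rewrite inE => /andP [/andP [_ jI] ji]; rewrite linearZ /= (part_ortho iI jI) ?mulr0 // eq_sym.
Qed.

Lemma pr_refls e K x y : K \subset Ip e ->
  pr x (refls K y) = pr x y - sg e * \sum_(i in K) co i x * '[alpha i, y].
Proof.
move=> /subsetP KI; rewrite mulmxBl raddfB; congr (_ - _).
rewrite mulmx_suml raddf_sum /= mulr_sumr; apply: eq_bigr => i iK.
rewrite -scalemxAl linearZ /= prC pr_alpha copairE (eps_part (KI _ iK)).
by field; rewrite gt_eqF ?half_sqnorm_gt0.
Qed.

(** Expand both sides by [pr_refls]. The terms mixing the two halves occur once on each side and
    cancel by symmetry of the form; the diagonal terms add up to twice [pr x y]. *)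
Lemma pr_flip J e x y : supp J x -> supp J y ->
  pr x (refls (J :&: Ip e) y) = - pr (refls (J :&: Ip (~~ e)) x) y.
Proof.
move=> xJ yJ; rewrite [in RHS]prC !(pr_refls _ _ (subsetIr _ _)) sgN [pr y x]prC.
suff -> : pr x y = sg e / 2 * (\sum_(i in J :&: Ip e) co i x * '[alpha i, y]
   - \sum_(i in J :&: Ip (~~ e)) co i y * '[alpha i, x]) by field.
rewrite prE (@sum_parts J e) => [|i iJ]; last by rewrite xJ // mulr0 mul0r.
have part e' z w : supp J z -> supp J w ->
    \sum_(i in J :&: Ip e') co i z * '[alpha i, w] =
    2 * sg e' * (\sum_(i in J :&: Ip e') eps R Iplus i * half_sqnorm i * co i z * co i w) +
    \sum_(i in J :&: Ip e') \sum_(j in J :&: Ip (~~ e')) co i z * co j w * '[alpha i, alpha j].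
  move=> zJ wJ; rewrite mulr_sumr -big_split /=; apply: eq_bigr => i /setIP [iJ iI].
  rewrite (ip_part iI wJ iJ) mulrDr mulr_sumr (eps_part iI); congr (_ + _).
    by rewrite -[LHS]mul1r -(sg_sqr e'); ring.
  by apply: eq_bigr => j _; rewrite mulrA.
rewrite !part // negbK exchange_big /= sgN.
set S1 := \sum_(i in _) _ ; set S2 := \sum_(i in J :&: Ip (~~ e)) _.
set S3 := \sum_(i in _) _ ; set S4 := \sum_(i in _) _ ; set S5 := \sum_(i in _) _.
have -> : S4 = S2 by apply: eq_bigr => i _; ring.
have -> : S5 = S3.
  by apply: eq_bigr => i _; apply: eq_bigr => j _; rewrite ipC; ring.
transitivity (sg e * sg e * (S1 + S2)); first by rewrite sg_sqr mul1r.
by field.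
Qed.

(** * Positive roots under half Coxeter elements *)

Lemma root_sign b : b \in Phi ->
  (forall i, 0 <= co i b) \/ (forall i, co i b <= 0).
Proof.
case: simplePhi => _ _ /[apply] -[c [-> cP]].
by case: cP => c0; [left|right] => i; rewrite co_sum ?ler0z ?lerz0.
Qed.

Definition pos_root b := b \in Phi /\ forall i, 0 <= co i b.

Lemma positive_rootP b : positive_root Phi alpha b <-> pos_root b.
Proof.
split=> [[bP [c [c0 bE]]]|[bP b0]]; split=> //; first by move=> i; rewrite bE co_sum.
by exists (co^~ b); split=> //; apply: coE.
Qed.

Lemma root_pos b i : b \in Phi -> 0 < co i b -> pos_root b.
Proof. by move=> bP bi; split=> //; case: (root_sign bP) => // /(_ i); rewrite leNgt bi. Qed.

Lemma co_opp_alpha i j : co i (- alpha j) = - (i == j)%:R.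
Proof. by rewrite raddfN /= co_alpha. Qed.

Lemma pos_root_alpha i : pos_root (alpha i).
Proof. by split=> [|j]; rewrite ?alpha_root // co_alpha ler0n. Qed.

Lemma opp_alpha_inj i j : - alpha i = - alpha j -> i = j.
Proof. by move/oppr_inj/alpha_inj. Qed.

Lemma pos_root_opp i : ~ pos_root (- alpha i).
Proof. by case=> _ /(_ i); rewrite co_opp_alpha eqxx lerNr oppr0 leNgt ltr01. Qed.

Lemma refls_alpha e K i : K \subset Ip e -> i \in K -> refls K (alpha i) = - alpha i.
Proof.
move=> /subsetP KI iK; apply: co_inj => j; rewrite co_refls co_opp_alpha co_alpha.
case: eqP => [->|/eqP ji]; first by rewrite iK copair_self mul1r mulr1n; ring.
case jK: (j \in K); last by rewrite mul0r subr0 oppr0.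
by rewrite copairE (part_ortho (KI _ jK) (KI _ iK) ji) mul0r mulr0 subr0 oppr0.
Qed.

(** A positive coordinate outside [K] is unchanged and fixes the sign of the image. Otherwise [b] is
    supported on mutually orthogonal simple roots, which forces it to be one of them. *)
Lemma pos_root_refls e K b : K \subset Ip e -> pos_root b ->
  pos_root (refls K b) \/ exists2 i, i \in K & b = alpha i.
Proof.
move=> KI [bP b0].
case: (pickP (fun j => (j \notin K) && (co j b != 0))) => [j /andP[jK bj]|suppb].
  left; apply: (@root_pos _ j); first exact: (refls_root KI).
  by rewrite co_refls_out // lt_def bj b0.
have {}suppb j : j \notin K -> co j b = 0.
  by move=> jK; apply/eqP; have := suppb j; rewrite jK /= => /negbFE.
have [i bi] : exists i, co i b != 0.
  apply/existsP; apply: contraNT (root_neq0 bP); rewrite negb_exists => /forallP h.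
  by apply/eqP/co_inj => j; rewrite raddf0; apply/eqP; have := h j; rewrite negbK.
have iK : i \in K by apply: contraNT bi => /suppb ->.
right; exists i => //.
have bK : b = \sum_(j in K) co j b *: alpha j.
  rewrite {1}[b]coE [RHS]big_mkcond; apply: eq_bigr => j _.
  by case: ifP => // /negbT/suppb ->; rewrite scale0r.
have bE : copair B (alpha i) b = 2 * co i b.
  by rewrite {1}bK (copair_sum _ KI (subsetP KI _ iK)) iK mul1r.
have bi_gt0 : 0 < co i b by rewrite lt_def bi b0.
have co_rb j : co j (refl B (alpha i) b) = co j b - 2 * co i b * (j == i)%:R.
  by rewrite /refl raddfB /= linearZ /= co_alpha bE.
(* Reflection in [alpha i] makes coordinate [i] negative and keeps the others, so the image is a
   negative root and the kept coordinates are at most 0. *)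
have bj j : j != i -> co j b = 0.
  move=> /negPf ji; apply/eqP; rewrite eq_le b0 andbT.
  case: (root_sign (refl_root (alpha_root i) bP)) => h.
    by have := h i; rewrite co_rb eqxx mulr1; lra.
  by have := h j; rewrite co_rb ji mulr0 subr0.
have {}bE : b = co i b *: alpha i.
  apply: co_inj => j; rewrite linearZ /= co_alpha.
  by case: (eqVneq j i) => [->|/bj ->]; rewrite ?mulr1 ?mulr0.
case: rootPhi => _ _ _ _ /(_ _ (co i b) (alpha_root i)); rewrite -bE => /(_ bP).
case=> b1; first by rewrite bE b1 scale1r.
by move: bi_gt0; rewrite b1 oppr_gt0 ltr10.
Qed.

(** * Almost positive roots of a standard parabolic, cut out of [Phi] by support, and their
    involutions *)

Definition apr J x := (pos_root x \/ exists2 i, i \in J & x = - alpha i) /\ supp J x.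

Definition frozen e x := [exists i, (x == - alpha i) && (i \in Ip (~~ e))].

Lemma frozenP e x : reflect (exists2 i, i \in Ip (~~ e) & x = - alpha i) (frozen e x).
Proof.
apply: (iffP existsP) => [[i /andP[/eqP-> iI]]|[i iI ->]]; exists i => //.
by rewrite eqxx.
Qed.

(* The map tau of the standard parabolic subsystem on the simple roots in [J]. *)
Definition tauJ J e x := if frozen e x then x else refls (J :&: Ip e) x.

Lemma tauE e x : tau B alpha Iplus e x = tauJ setT e x.
Proof. by rewrite /tauJ setTI -(@refls_enum e). Qed.

Lemma supp_refls J K x : K \subset J -> supp J x -> supp J (refls K x).
Proof.
move=> /subsetP KJ xJ i iJ; rewrite co_refls_out ?xJ //.
by apply: contra iJ; apply: KJ.
Qed.

Lemma supp_alpha J i : i \in J -> supp J (alpha i).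
Proof. by move=> iJ j jJ; rewrite co_alpha; case: eqP jJ => // ->; rewrite iJ. Qed.

Lemma supp_opp J x : supp J x -> supp J (- x).
Proof. by move=> xJ j jJ; rewrite raddfN /= xJ ?oppr0. Qed.

Lemma apr_opp_alpha J i : i \in J -> apr J (- alpha i).
Proof. by move=> iJ; split; [right; exists i|apply/supp_opp/supp_alpha]. Qed.

Lemma apr_alpha J i : i \in J -> apr J (alpha i).
Proof. by move=> iJ; split; [left; apply: pos_root_alpha|apply: supp_alpha]. Qed.

Lemma frozen_pos e x : pos_root x -> ~~ frozen e x.
Proof. by move=> xP; apply/negP => /frozenP [i _ xE]; apply: (@pos_root_opp i); rewrite -xE. Qed.

Lemma tauJ_pos J e x : pos_root x -> tauJ J e x = refls (J :&: Ip e) x.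
Proof. by move=> xP; rewrite /tauJ (negPf (frozen_pos e xP)). Qed.

Lemma frozen_opp_alpha e i : frozen e (- alpha i) = (i \in Ip (~~ e)).
Proof.
apply/frozenP/idP => [[j jI /opp_alpha_inj ->]//|iI].
by exists i.
Qed.

(** For [i] in [J :&: Ip e] the roots [alpha i] and [- alpha i] are exchanged; every other positive
    root stays positive. *)
Lemma refls_unfrozen J e x : apr J x -> ~~ frozen e x ->
  apr J (refls (J :&: Ip e) x) /\ ~~ frozen e (refls (J :&: Ip e) x).
Proof.
have KI : J :&: Ip e \subset Ip e by apply: subsetIr.
move=> [x_pm xJ] xe; case: x_pm => [xP|[i iJ xE]].
  case: (pos_root_refls KI xP) => [rP|[i iK xE]].
    split; last exact: frozen_pos.
    by split; [left|apply: supp_refls xJ; apply: subsetIl].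
  rewrite xE (refls_alpha KI iK); case/setIP: iK => iJ iI.
  by rewrite frozen_opp_alpha Ip_neg iI; split; first exact: apr_opp_alpha.
rewrite xE frozen_opp_alpha Ip_neg negbK in xe.
have iK : i \in J :&: Ip e by rewrite inE iJ.
rewrite xE raddfN /= (refls_alpha KI iK) opprK.
by split; [apply: apr_alpha|apply/frozen_pos/pos_root_alpha].
Qed.

Lemma tauJ_apr J e x : apr J x -> apr J (tauJ J e x).
Proof. by rewrite /tauJ; case: (boolP (frozen e x)) => // xe /refls_unfrozen/(_ xe) []. Qed.

Lemma tauJ_frozen J e x : apr J x -> frozen e (tauJ J e x) = frozen e x.
Proof.
rewrite /tauJ; case: (boolP (frozen e x)) => // xe /refls_unfrozen/(_ xe) [_].
by move/negPf.
Qed.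

Lemma tauJK J e x : apr J x -> tauJ J e (tauJ J e x) = x.
Proof.
move=> xJ; rewrite {1}/tauJ tauJ_frozen // /tauJ; case: (frozen e x) => //.
by rewrite (reflsK (subsetIr _ _)).
Qed.

Lemma co_tauJ_out J e i x : i \notin Ip e -> co i (tauJ J e x) = co i x.
Proof. by move=> iI; rewrite /tauJ; case: ifP => // _; rewrite co_refls_out // inE (negPf iI) andbF. Qed.

Lemma apr_co_ge0 J i x : apr J x -> x != - alpha i -> 0 <= co i x.
Proof.
case=> -[[_ + _]|[j _ -> _]]; first exact.
by rewrite co_opp_alpha; case: (eqVneq i j) => [->|_ _]; rewrite ?eqxx // oppr0.
Qed.

(** * Compatibility as a sign condition on the pairing *)

Lemma pr_oppl_alpha i x : pr (- alpha i) x = - (eps R Iplus i * half_sqnorm i * co i x).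
Proof. by rewrite prNl pr_alpha. Qed.

(* The sign of the pairing after one half Coxeter step encodes compatibility
   and, unlike the recursive definition, restricts to standard parabolics. *)
Definition compJ J e x y :=
  (sg e * pr x (tauJ J e y) <= 0) && (sg e * pr (tauJ J e x) y <= 0).

Lemma compJC J e x y : compJ J e x y = compJ J e y x.
Proof. by rewrite /compJ andbC [pr x _]prC [pr (tauJ J e x) y]prC. Qed.

(** If [i] is in [Ip e], the second inequality of [compJ] says [co i y <= 0] and implies the first;
    otherwise [- alpha i] is frozen, coordinate [i] is untouched, and both inequalities say this. *)
Lemma compJ_opp_alpha J e i y : apr J y -> i \in J -> y != - alpha i ->
  compJ J e (- alpha i) y = (co i y == 0).
Proof.
move=> yJ iJ yi; have yi_ge0 := apr_co_ge0 yJ yi; have hi := half_sqnorm_gt0 i.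
have le0 c : half_sqnorm i * c <= 0 = (c <= 0) by rewrite pmulr_rle0.
rewrite [RHS]eq_le yi_ge0 andbT /compJ; case: (boolP (i \in Ip e)) => iI.
  have iK : i \in J :&: Ip e by rewrite inE iJ.
  have ti : tauJ J e (- alpha i) = alpha i.
    by rewrite /tauJ frozen_opp_alpha Ip_neg iI raddfN /= (refls_alpha (subsetIr _ _) iK) opprK.
  rewrite ti pr_alpha pr_oppl_alpha (eps_part iI) mulrN !mulrA sg_sqr !mul1r le0.
  (* A negative coordinate [i] in [tauJ J e y] would mean [tauJ J e y = - alpha i], hence
     [y = alpha i]. *)
  apply: andb_idl => yi0; rewrite oppr_le0 mulr_ge0 ?(ltW hi) //.
  apply: (apr_co_ge0 (tauJ_apr e yJ)); apply/eqP => /(congr1 (tauJ J e)).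
  rewrite tauJK // ti => yE; move: yi0; rewrite yE co_alpha eqxx.
  by rewrite leNgt ltr01.
have iI' : i \in Ip (~~ e) by rewrite Ip_neg.
rewrite {2}/tauJ frozen_opp_alpha iI' !pr_oppl_alpha co_tauJ_out // (eps_part iI') sgN.
by rewrite mulNr mulNr opprK !mulrA sg_sqr mul1r le0 andbb.
Qed.

(** On positive roots, [pr_flip] exchanges the two inequalities of [compJ]; at a negative simple
    root the criterion of [compJ_opp_alpha] is independent of [e]. *)
Lemma compJ_flip J e x y : apr J x -> apr J y -> x != y ->
  compJ J (~~ e) x y = compJ J e x y.
Proof.
move=> xJ yJ; have [xP xs] := xJ; have [yP ys] := yJ.
case: xP => [xP|[i iJ ->]]; last by rewrite eq_sym => yi; rewrite !compJ_opp_alpha.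
case: yP => [yP|[i iJ ->]]; last by move=> xi; rewrite !(compJC _ _ x) !compJ_opp_alpha.
rewrite /compJ !tauJ_pos // sgN.
by rewrite (@pr_flip J e x y) // (@pr_flip J (~~ e) x y) // negbK !mulNr !mulrN !opprK andbC.
Qed.

Lemma compJ_tau J e x y : apr J x -> apr J y ->
  compJ J e (tauJ J e x) (tauJ J e y) = compJ J e x y.
Proof. by move=> xJ yJ; rewrite /compJ !tauJK // andbC. Qed.

(** A reflection outside [J] contributes a term with factor [co i x], which vanishes. *)
Lemma pr_tauJ_setT J e x y : supp J x -> supp J y ->
  pr x (tauJ setT e y) = pr x (tauJ J e y).
Proof.
move=> xJ yJ; rewrite /tauJ; case: ifP => // _.
rewrite !(pr_refls _ _ (subsetIr _ _)); congr (_ - _ * _).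
rewrite big_mkcond [RHS]big_mkcond /=; apply: eq_bigr => i _.
by rewrite !inE /=; case: (boolP (i \in J)) => // iJ; rewrite xJ // mul0r; case: ifP.
Qed.

Lemma compJ_setT J e x y : supp J x -> supp J y -> compJ setT e x y = compJ J e x y.
Proof. by move=> xJ yJ; rewrite /compJ !(prC (tauJ _ _ _)) !(pr_tauJ_setT _ (J := J)). Qed.

(** The sign [true] is an arbitrary choice: for distinct almost positive roots, [compatE] allows
    either sign and any parabolic containing both. *)
Definition compat x y := compJ setT true x y.

Lemma compatE J e x y : apr J x -> apr J y -> x != y -> compat x y = compJ J e x y.
Proof.
move=> xJ yJ xy; rewrite /compat (compJ_setT _ xJ.2 yJ.2).
by case: e => //; rewrite -compJ_flip.
Qed.

Lemma tauJ_inj J e x y : apr J x -> apr J y -> tauJ J e x = tauJ J e y -> x = y.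
Proof. by move=> xJ yJ /(congr1 (tauJ J e)); rewrite !tauJK. Qed.

Lemma compat_tau J e x y : apr J x -> apr J y -> x != y ->
  compat (tauJ J e x) (tauJ J e y) = compat x y.
Proof.
move=> xJ yJ xy; rewrite !(@compatE J e) ?compJ_tau //; try exact: tauJ_apr.
by apply: contra xy => /eqP/tauJ_inj ->.
Qed.

Lemma compat_opp_alpha J i y : apr J y -> i \in J -> y != - alpha i ->
  compat (- alpha i) y = (co i y == 0).
Proof.
move=> yJ iJ yi; rewrite (@compatE J true) ?compJ_opp_alpha // 1?eq_sym //.
exact: apr_opp_alpha.
Qed.

(** * Reaching a negative simple root from any almost positive root *)

Inductive reach J : V -> Prop :=
| reach_opp_alpha i : i \in J -> reach J (- alpha i)
| reach_tau e x : reach J (tauJ J e x) -> reach J x.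

Lemma ip_alpha_eq0 v : (forall i, co i v = 0 \/ '[alpha i, v] = 0) -> v = 0.
Proof.
move=> v0; apply/eqP; rewrite -ip_eq0 {1}[v]coE ip_suml big1 // => i _.
by rewrite ipC linearZ /= ipC; case: (v0 i) => ->; rewrite ?mul0r ?mulr0.
Qed.

Lemma refls_eq_ip K i v : i \in K -> co i (refls K v) = co i v -> '[alpha i, v] = 0.
Proof.
move=> iK /eqP; rewrite co_refls iK mul1r copairE -subr_eq0 addrAC subrr sub0r oppr_eq0.
by rewrite mulf_eq0 invr_eq0 (gt_eqF (half_sqnorm_gt0 i)) orbF => /eqP.
Qed.

(* A root whose orbit under the Coxeter element stays positive would sum over
   a period to a nonzero fixed vector, but a fixed vector is fixed by both half
   Coxeter elements, hence orthogonal to all simple roots. *)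
Lemma apr_reach J x : apr J x -> reach J x.
Proof.
move=> xJ; pose step := tauJ J false \o tauJ J true; pose u m := iter m step x.
have uJ m : apr J (u m) by elim: m => // m um; exact: (tauJ_apr false (tauJ_apr true um)).
have reach_u m y : reach J (iter m step y) -> reach J y.
  by elim: m y => // m IHm y; rewrite iterSr => /IHm/reach_tau/reach_tau.
pose isneg y := [exists i, (i \in J) && (y == - alpha i)].
have reach_neg y : isneg y -> reach J y.
  by case/existsP => i /andP[iJ /eqP->]; apply: reach_opp_alpha.
have not_neg y : apr J y -> ~~ isneg y -> pos_root y.
  by case=> -[//|[i iJ ->]] _ /negP[]; apply/existsP; exists i; rewrite iJ /=.
case: (boolP [exists m : 'I_(size Phi).+1, isneg (u m) || isneg (tauJ J true (u m))]).
  case/existsP=> m /orP[/reach_neg|/reach_neg/reach_tau] /reach_u //.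
rewrite negb_exists => /forallP uN.
have {uN} u_pos m : (m <= size Phi)%N ->
    pos_root (u m) /\ u m.+1 = refls (J :&: Ip false) (refls (J :&: Ip true) (u m)).
  move=> mP; have := uN (Ordinal (mP : (m < (size Phi).+1)%N)).
  rewrite negb_or => /andP[/(not_neg _ (uJ m)) up].
  move=> /(not_neg _ (tauJ_apr true (uJ m))) tp; split=> //.
  by rewrite -(tauJ_pos J true) // -(tauJ_pos J false).
(* One iterate more than the size of [Phi], all of them roots, so two coincide. *)
pose s := [seq u m | m <- iota 0 (size Phi).+1].
have : ~~ uniq s.
  apply: contraL (ltnSn (size Phi)) => us; rewrite -leqNgt.
  have -> : (size Phi).+1 = size s by rewrite size_map size_iota.
  apply: uniq_leq_size us _ => y /mapP[m]; rewrite mem_iota add0n ltnS => /u_pos[[uP _] _] ->.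
  exact: uP.
case/(uniqPn 0)=> a [b [ab]]; rewrite size_map size_iota ltnS => bP.
have aP := ltnW (leq_trans ab bP).
rewrite !(nth_map 0%N) ?size_iota ?nth_iota ?add0n ?ltnS // => uab.
pose v := \sum_(a <= m < b) u m.
have in_range m : (a <= m < b)%N -> (m <= size Phi)%N.
  by case/andP=> _ kb; apply: ltnW (leq_trans kb bP).
have vE : refls (J :&: Ip false) (refls (J :&: Ip true) v) = v.
  have -> : refls (J :&: Ip false) (refls (J :&: Ip true) v) = \sum_(a <= m < b) u m.+1.
    by rewrite !raddf_sum; apply: eq_big_nat => m /in_range/u_pos[_ ->].
  apply/eqP; rewrite -subr_eq0 -sumrB telescope_sumr ?(ltnW ab) // uab subrr //.
have {}vE : refls (J :&: Ip true) v = refls (J :&: Ip false) v.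
  by rewrite -{2}vE (reflsK (subsetIr _ _)).
have v0 : v = 0.
  (* Both half Coxeter elements send [v] to the same vector, and each coordinate is altered by at
     most one of them, hence by neither. *)
  apply: ip_alpha_eq0 => i; case: (boolP (i \in J)) => iJ; last first.
    by left; rewrite raddf_sum big1_seq //= => m _; rewrite (uJ m).2.
  right; have iF : (i \in Ip false) = (i \notin Ip true) := Ip_neg true i.
  case: (boolP (i \in Ip true)) => iI.
    apply: (@refls_eq_ip (J :&: Ip true)); first by rewrite in_setI iJ.
    by rewrite vE co_refls_out // in_setI iF iI andbF.
  apply: (@refls_eq_ip (J :&: Ip false)); first by rewrite in_setI iJ iF.
  by rewrite -vE co_refls_out // in_setI (negPf iI) andbF.
(* The vanishing sum has nonnegative coordinates in every term, so its first term [u a] is zero,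
   which no root is. *)
have [[/root_neq0/eqP ua0 _] _] := u_pos a aP; case: ua0; apply: co_inj => i; rewrite raddf0.
have /eqP := congr1 (co i) v0; rewrite raddf0 /v big_ltn // raddfD raddf_sum /=.
rewrite paddr_eq0 => [/andP[/eqP]//||]; first by have [[_ ->]] := u_pos a aP.
rewrite big_nat_cond; apply: sumr_ge0 => m /andP[/andP[ak kb] _].
by have [|[_ ->]] := u_pos m; rewrite // in_range // kb ltnW.
Qed.

(** * Parabolic clusters and their dual roots *)

Definition par_cluster J (C : seq V) :=
  [/\ forall x, x \in C -> apr J x,
      forall x y, x \in C -> y \in C -> x != y -> compat x y
    & forall z, apr J z -> (forall x, x \in C -> z != x -> compat z x) -> z \in C].

(* The roots [b] are the inner facet normals of the image cone, and the first
   clause says, dually, that the cluster spans. *)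
Definition root_dual J (C : seq V) :=
  (forall w, supp J w -> (forall x, x \in C -> pr w x = 0) -> w = 0) /\
  (forall x, x \in C -> exists b,
     [/\ b \in Phi, supp J b, 0 < pr b x & forall y, y \in C -> y != x -> pr b y = 0]).

Lemma par_cluster_tau J e C : par_cluster J C -> par_cluster J (map (tauJ J e) C).
Proof.
case=> CJ Cc Cmax; split=> [_ /mapP[x xC ->]|_ _ /mapP[x xC ->] /mapP[y yC ->] xy|z zJ zC].
- by apply: tauJ_apr; apply: CJ.
- have {}xy : x != y by apply: contraNneq xy => ->.
  by rewrite (compat_tau e (CJ _ xC) (CJ _ yC)) // Cc.
rewrite -(tauJK e zJ); apply/map_f/Cmax => [|x xC zx]; first exact: tauJ_apr.
rewrite -(compat_tau e (tauJ_apr e zJ) (CJ _ xC) zx) tauJK // zC ?map_f //.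
by apply: contraNneq zx => ->; rewrite (tauJK e (CJ _ xC)).
Qed.

Lemma supp_opp_alpha J i : supp J (- alpha i) -> i \in J.
Proof.
move=> iJ; apply: contraT => /iJ/eqP.
by rewrite co_opp_alpha eqxx oppr_eq0 oner_eq0.
Qed.

Lemma pr_opp_alpha_eq0 w i : (pr w (- alpha i) == 0) = (co i w == 0).
Proof.
rewrite prC pr_oppl_alpha oppr_eq0 mulf_eq0 mulf_eq0 (negPf (eps_neq0 _)).
by rewrite (gt_eqF (half_sqnorm_gt0 i)).
Qed.

Lemma opp_alpha_dual J i (C : seq V) : i \in J ->
  (forall x, x \in C -> x != - alpha i -> co i x = 0) ->
  exists b, [/\ b \in Phi, supp J b, 0 < pr b (- alpha i)
    & forall y, y \in C -> y != - alpha i -> pr b y = 0].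
Proof.
(* This sign cancels the one in the pairing, so that [b] is positive on [- alpha i] in either
   half. *)
move=> iJ co0; pose b := - eps R Iplus i *: alpha i.
have prb y : pr b y = - (half_sqnorm i * co i y).
  rewrite prC -scalemxAl linearZ /= prC pr_alpha mulNr !mulrA.
  by congr (- (_ * _)); rewrite /eps; case: ifP => _; rewrite ?mulrNN ?mul1r.
exists b; split=> [||| y yC yi].
- by rewrite /b /eps; case: ifP => _; rewrite ?opprK ?scale1r ?scaleN1r ?opp_root ?alpha_root.
- by move=> j jJ; rewrite linearZ /= (supp_alpha iJ jJ) mulr0.
- by rewrite prb co_opp_alpha eqxx mulrN mulr1 opprK half_sqnorm_gt0.
- by rewrite prb co0 // mulr0 oppr0.
Qed.

Lemma root_dual_tau J e C :
  par_cluster J C -> root_dual J (map (tauJ J e) C) -> root_dual J C.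
Proof.
case=> CJ Cc _ [spanC dualC].
pose N := [set j in J :&: Ip (~~ e) | - alpha j \in C].
pose K := (J :&: Ip (~~ e)) :\: N.
have KI : K \subset Ip (~~ e) by apply: subset_trans (subsetDl _ _) (subsetIr _ _).
have KJ : K \subset J by apply: subset_trans (subsetDl _ _) (subsetIl _ _).
have frozenC x : x \in C -> frozen e x -> exists2 j, j \in N & x = - alpha j.
  move=> xC /frozenP[j jI xE]; exists j; rewrite // !inE -xE xC jI.
  by rewrite andbT (@supp_opp_alpha J) // -xE; case: (CJ _ xC).
have frozenN j : j \in N -> frozen e (- alpha j).
  by rewrite !inE frozen_opp_alpha => /andP[/andP[]].
have NC j : j \in N -> - alpha j \in C by rewrite inE => /andP[].
have NJ j : j \in N -> j \in J by rewrite !inE => /andP[/andP[]].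
have NK j : j \in N -> j \notin K by move=> jN; rewrite in_setD jN.
have coN j x : j \in N -> x \in C -> x != - alpha j -> co j x = 0.
  move=> jN xC xj; apply/eqP; rewrite -(compat_opp_alpha (CJ _ xC) (NJ _ jN) xj).
  by rewrite Cc ?NC // eq_sym.
(* On an unfrozen member the coordinates in [N] vanish, so [refls K] can replace the full product in
   [pr_flip]; on a frozen one both factors lack the needed coordinate of [w]. *)
have prK w x : supp J w -> (forall j, j \in N -> co j w = 0) -> x \in C ->
    pr (refls K w) (tauJ J e x) = if frozen e x then 0 else - pr w x.
  move=> wJ wN xC; rewrite /tauJ; case: ifP => [/(frozenC _ xC)[j jN ->]|xe].
    by rewrite prC pr_oppl_alpha co_refls_out ?NK // wN // mulr0 oppr0.
  have xJ := (CJ _ xC).2.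
  rewrite (pr_flip e (supp_refls KJ wJ) xJ) -{2}[w](reflsK KI); congr (- _).
  rewrite !(prC _ x) (pr_refls _ _ KI) (pr_refls _ _ (subsetIr _ _)); congr (_ - _ * _).
  rewrite big_mkcond [RHS]big_mkcond; apply: eq_bigr => i _; rewrite in_setD.
  case: (boolP (i \in N)) => //= iN; rewrite (coN i) ?mul0r //; first by case: ifP.
  by apply: contraFneq xe => ->; apply: frozenN.
have pr0_co w j : pr w (- alpha j) = 0 -> co j w = 0.
  by move/eqP; rewrite pr_opp_alpha_eq0 => /eqP.
(* On the span of [C], tau is linear: it fixes the members -alpha_j with j in
   [N] and is a product of reflections on the others, which have no alpha_j
   component; the adjoint is then the parabolic product [refls K]. *)
split=> [w wJ w0|x xC].
  have wN j : j \in N -> co j w = 0 by move=> jN; apply/pr0_co/w0/NC.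
  rewrite -(reflsK KI w) (spanC (refls K w)) ?raddf0 //; first exact: supp_refls.
  by move=> _ /mapP[x xC ->]; rewrite prK // w0 // oppr0; case: ifP.
case: (boolP (frozen e x)) => [/(frozenC _ xC)[j jN xE]|xe].
  rewrite xE; apply: opp_alpha_dual (NJ _ jN) _ => y; exact: coN.
have [b [bP bJ bx b0]] := dualC _ (map_f _ xC).
have bN j : j \in N -> co j b = 0.
  move=> jN; have jE : tauJ J e (- alpha j) = - alpha j by rewrite /tauJ frozenN.
  apply/pr0_co/b0; first by rewrite -jE map_f ?NC.
  rewrite -jE; apply: contraNneq xe => /(tauJ_inj (CJ _ (NC _ jN)) (CJ _ xC)) <-.
  exact: frozenN.
have rN j : j \in N -> co j (refls K b) = 0.
  by move=> jN; rewrite co_refls_out ?bN ?NK.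
have prb y : y \in C -> ~~ frozen e y -> pr (- refls K b) y = pr b (tauJ J e y).
  by move=> yC ye; rewrite prNl -{2}[b](reflsK KI) prK ?(negPf ye) //; apply: supp_refls.
(* The minus sign offsets the one in the adjunction. *)
exists (- refls K b); split.
- by apply/opp_root/(refls_root KI).
- exact/supp_opp/supp_refls.
- by rewrite prb.
move=> y yC yx; case: (boolP (frozen e y)) => [/(frozenC _ yC)[j jN ->]|ye].
  by apply/eqP; rewrite pr_opp_alpha_eq0 raddfN /= rN // oppr0.
rewrite prb // b0 ?map_f //.
by apply: contraNneq yx => /(tauJ_inj (CJ _ yC) (CJ _ xC)) ->.
Qed.

(** * Induction on the rank by deleting a negative simple root *)

Lemma supp_setD1 J i x : supp J x -> co i x = 0 -> supp (J :\ i) x.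
Proof.
move=> xJ xi j; rewrite !inE negb_and negbK => /orP[/eqP->//|].
exact: xJ.
Qed.

Lemma suppS J K x : J \subset K -> supp J x -> supp K x.
Proof. by move=> /subsetP JK xJ i iK; apply/xJ; apply: contra iK; apply: JK. Qed.

Lemma aprS J K x : J \subset K -> apr J x -> apr K x.
Proof.
move=> JK [xP xJ]; split; last exact: suppS xJ.
by case: xP => [|[i iJ xE]]; [left|right; exists i => //; apply: (subsetP JK)].
Qed.

(** Compatibility with [- alpha i] is the vanishing of coordinate [i]. Maximality survives because
    every candidate supported off [i] is automatically compatible with [- alpha i]. *)
Lemma par_cluster_setD1 J i C : i \in J -> par_cluster J C -> - alpha i \in C ->
  (forall x, x \in C -> x != - alpha i -> co i x = 0) /\
  par_cluster (J :\ i) [seq x <- C | x != - alpha i].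
Proof.
move=> iJ [CJ Cc Cmax] iC.
have co0 x : x \in C -> x != - alpha i -> co i x = 0.
  move=> xC xi; apply/eqP.
  by rewrite -(compat_opp_alpha (CJ _ xC) iJ xi) Cc // eq_sym.
split=> //; split=> [x|x y|z zJ zC].
- rewrite mem_filter => /andP[xi xC]; have [xP xJ] := CJ _ xC.
  split; last by apply: supp_setD1 => //; apply: co0.
  case: xP => [|[j jJ xE]]; [by left|right; exists j => //].
  by rewrite !inE jJ andbT; apply: contraNneq xi => <-; rewrite xE.
- by rewrite !mem_filter => /andP[_ xC] /andP[_ yC]; apply: Cc.
have zi0 : co i z = 0 by apply: zJ.2; rewrite !inE eqxx.
have zi : z != - alpha i.
  by apply: contra_eq_neq zi0 => ->; rewrite co_opp_alpha eqxx oppr_eq0 oner_eq0.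
have zJ' : apr J z by apply: aprS zJ; apply: subsetDl.
rewrite mem_filter zi Cmax // => x xC zx; case: (eqVneq x (- alpha i)) => [->|xi].
  by rewrite /compat compJC -/(compat _ _) (compat_opp_alpha zJ') // zi0.
by apply: zC => //; rewrite mem_filter xi.
Qed.

(** Dual roots of the smaller cluster have no [alpha i] coordinate, so they pair to zero with
    [- alpha i]; that element receives its own dual root from [opp_alpha_dual]. *)
Lemma root_dual_setD1 J i C : i \in J -> - alpha i \in C ->
  (forall x, x \in C -> x != - alpha i -> co i x = 0) ->
  root_dual (J :\ i) [seq x <- C | x != - alpha i] -> root_dual J C.
Proof.
move=> iJ iC co0 [spanC dualC]; split=> [w wJ w0|x xC].
  apply: spanC => [|x]; last by rewrite mem_filter => /andP[_ /w0].
  apply: supp_setD1 => //; by apply/eqP; rewrite -pr_opp_alpha_eq0 w0.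
case: (eqVneq x (- alpha i)) => [->|xi]; first exact: opp_alpha_dual.
have [|b [bP bJ bx b0]] := dualC x; first by rewrite mem_filter xi.
exists b; split=> // [|y yC yx]; first by apply: suppS bJ; apply: subsetDl.
case: (eqVneq y (- alpha i)) => [->|yi]; last by apply: b0; rewrite // mem_filter yi.
by apply/eqP; rewrite pr_opp_alpha_eq0 bJ // !inE eqxx.
Qed.

Lemma par_cluster_dual J C : par_cluster J C -> root_dual J C.
Proof.
move: {2}#|J| (leqnn #|J|) => m; elim: m J C => [|m IHm] J C Jm CJ.
  have J0 : J = set0 by apply/eqP; rewrite -cards_eq0 -leqn0.
  split=> [w wJ _|x xC]; first by apply: co_inj => i; rewrite raddf0 wJ // J0 inE.
  case: CJ => /(_ x xC) [xP xJ] _ _.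
  have x0 : x = 0 by apply: co_inj => i; rewrite raddf0 xJ // J0 inE.
  case: xP => [[/root_neq0]|[i iJ xE]]; first by rewrite x0 eqxx.
  by rewrite J0 inE in iJ.
(* The cluster moves together with its member [x], so it is quantified inside the induction on
   [reach]. *)
have reach_dual x : reach J x -> forall C, par_cluster J C -> x \in C -> root_dual J C.
  elim=> [i iJ|e {}x _ IHx] {CJ}C CJ xC.
    have [co0 CJ'] := par_cluster_setD1 iJ CJ xC.
    apply: (root_dual_setD1 iJ) => //; apply: IHm => //.
    by move: Jm; rewrite (cardsD1 i) iJ.
  by apply: (root_dual_tau (e := e) CJ); apply: IHx; [apply: par_cluster_tau|apply: map_f].
case: C CJ => [|x C] CJ; last first.
  apply: (reach_dual x) => //; last by rewrite mem_head.
  by apply: apr_reach; case: CJ => CJ _ _; apply: CJ; apply: mem_head.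
case: (set_0Vmem J) => [J0|[i iJ]].
  by apply: IHm => //; rewrite J0 cards0.
have [_ _ Cmax] := CJ.
(* With [J] nonempty, an empty cluster contradicts maximality. *)
by have : - alpha i \in [::] by apply: Cmax (apr_opp_alpha iJ) _.
Qed.

(** * Comparison with the recursive definition of clusters *)

Lemma almost_posP x : almost_pos Phi alpha x <-> apr setT x.
Proof.
split=> [[/positive_rootP xP|[i xE]]|[[xP|[i _ xE]] _]].
- by split; [left|move=> i; rewrite in_setT].
- by rewrite xE; apply/apr_opp_alpha/in_setT.
- by left; apply/positive_rootP.
- by right; exists i.
Qed.

Lemma coef_zeroP i x : coef_zero alpha i x <-> co i x = 0.
Proof.
split=> [[c [-> ci]]|xi]; first by rewrite co_sum.
by exists (co^~ x); split; [apply: coE|].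
Qed.

(** Both relations are invariant under [tau] and agree at negative simple roots, which every element
    reaches. The diagonal is excluded: [comp] makes [- alpha i] incompatible with itself, and
    clusters compare distinct elements only. *)
Lemma compatibility_compat (comp : V -> V -> Prop) x y :
  compatibility B Phi alpha Iplus comp ->
  apr setT x -> apr setT y -> x != y -> comp x y <-> compat x y.
Proof.
case=> _ compN comp_tau xT; have := apr_reach xT => xr.
elim: xr xT y => [i iT|e {}x _ IHx] xT y yT xy.
  rewrite compN ?coef_zeroP; last exact/almost_posP.
  rewrite eq_sym in xy.
  by rewrite (compat_opp_alpha yT iT xy); split=> /eqP.
rewrite (comp_tau _ _ _ _ e); [|exact/almost_posP..].
rewrite !tauE IHx ?compat_tau //; try exact: tauJ_apr.
by apply: contra xy => /eqP/(tauJ_inj xT yT) ->.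
Qed.

Lemma cluster_par_cluster (comp : V -> V -> Prop) C :
  compatibility B Phi alpha Iplus comp ->
  cluster Phi alpha comp C -> par_cluster setT C.
Proof.
move=> hcomp [CT Cc Cmax]; have {}CT x : x \in C -> apr setT x by move/CT/almost_posP.
split=> // [x y xC yC xy|z zT zC].
  by apply/(compatibility_compat hcomp (CT _ xC) (CT _ yC) xy)/Cc.
apply: Cmax => [|x xC zx]; first exact/almost_posP.
exact/(compatibility_compat hcomp zT (CT _ xC) zx)/zC.
Qed.

(** * Image cones as unions of Coxeter cones *)

Lemma M_unit : M \in unitmx.
Proof.
rewrite -row_free_unit -kermx_eq0; apply/eqP/row_matrixP => k.
have /sub_kermxP := row_sub k (kermx M); rewrite row0; move: (row k _) => v vM.
apply: co_inj => i; rewrite raddf0; apply/eqP.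
have /eqP := pr_alpha i v; rewrite vM raddf0 eq_sym mulf_eq0 mulf_eq0 (negPf (eps_neq0 i)).
by rewrite (gt_eqF (half_sqnorm_gt0 i)).
Qed.

(** A functional vanishing on [C] is represented by the pairing with some [w], which the first
    clause of [root_dual] forces to be zero. *)
Lemma root_dual_span C x : root_dual setT C ->
  exists c : 'I_(size C) -> R, x = \sum_k c k *: C`_k.
Proof.
case=> spanC _; pose A := \matrix_(k < size C) C`_k.
suff /(submx_full x)/submxP[D ->] : row_full A.
  exists (D 0); rewrite mulmx_sum_row; apply: eq_bigr => k _.
  by rewrite rowK.
rewrite -cokermx_eq0; apply/eqP/matrixP => i j; rewrite [RHS]mxE.
pose f (y : V) := (y *m cokermx A) 0 j.
(* Dividing by the diagonal entries of the pairing represents [f]. *)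
pose w := \sum_i (f (alpha i) / (eps R Iplus i * half_sqnorm i)) *: alpha i.
have fE y : pr w y = f y.
  rewrite prE {2}[y]coE /f mulmx_suml summxE; apply: eq_bigr => k _.
  rewrite co_sum -scalemxAl mxE -/(f _).
  by field; rewrite eps_neq0 gt_eqF ?half_sqnorm_gt0.
have w0 : w = 0.
  apply: spanC => [k|y /(nthP 0)[k kC <-]]; first by rewrite inE.
  have -> : C`_k = row (Ordinal kC) A by rewrite rowK.
  by rewrite fE /f -row_mul mulmx_coker row0 mxE.
have := fE (delta_mx 0 i); rewrite w0 ipC raddf0 /f -rowE mxE.
by move <-.
Qed.

Lemma cone_mem (S : seq V) x c : 0 <= c -> x \in S -> cone S (c *: x).
Proof.
move=> c0 xS; have xi : (index x S < size S)%N by rewrite index_mem.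
exists (fun k => if k == Ordinal xi then c else 0); split=> [k|]; first by case: ifP.
rewrite (bigD1 (Ordinal xi)) //= eqxx nth_index // big1 ?addr0 // => k /negPf ->.
by rewrite scale0r.
Qed.

Lemma cone_add (S : seq V) x y : cone S x -> cone S y -> cone S (x + y).
Proof.
move=> [c [c0 ->]] [d [d0 ->]]; exists (fun k => c k + d k); split=> [k|].
  by rewrite addr_ge0.
by rewrite -big_split; apply: eq_bigr => k _; rewrite scalerDl.
Qed.

Lemma cone0 (S : seq V) : cone S 0.
Proof. by exists (fun=> 0); split=> //; rewrite big1 // => k _; rewrite scale0r. Qed.

(** Expand [z *m invmx M] in the cluster: the coefficient at a member has the sign of [z] on the
    dual root, and that sign is controlled by the point [x *m M]. *)
Lemma cone_cox_cone (C S : seq V) x : root_dual setT C -> {subset S <= C} ->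
  cone S x -> forall z, cox_cone B Phi (x *m M) z -> cone S (z *m invmx M).
Proof.
move=> dualC SC [l [l0 xE]] z zx; set x' := z *m _.
have x'M : x' *m M = z by rewrite mulmxKV ?M_unit.
(* Removing repetitions makes distinct indices carry distinct vectors, so that a dual root isolates
   a single coefficient. *)
have dualU : root_dual setT (undup C).
  case: dualC => spanC dualC; split=> [w wT w0|y]; last first.
    rewrite mem_undup => /dualC[b [bP bT by0 b0]]; exists b; split=> // y'.
    by rewrite mem_undup; apply: b0.
  by apply: spanC => // y yC; apply: w0; rewrite mem_undup.
have [c x'E] := root_dual_span x' dualU; rewrite x'E.
apply: big_ind; [exact: cone0|exact: cone_add|move=> k _].
set y := (undup C)`_k; have yU : y \in undup C by apply: mem_nth.
have [b [bP _ by_gt0 b0]] := dualU.2 _ yU.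
have bx : '[b, x *m M] = \sum_(j < size S) l j * pr b S`_j.
  by rewrite xE mulmx_suml raddf_sum /=; apply: eq_bigr => j _; rewrite -scalemxAl linearZ.
have bS (j : nat) : (j < size S)%N -> S`_j != y -> pr b S`_j = 0.
  by move=> jS; apply: b0; rewrite mem_undup SC ?mem_nth.
have bz : '[b, z] = c k * pr b y.
  rewrite -x'M x'E mulmx_suml raddf_sum /= (bigD1 k) //= big1 => [|j jk].
    by rewrite -scalemxAl linearZ addr0.
  rewrite -scalemxAl linearZ /= b0 ?mulr0 ?mem_nth //.
  by rewrite nth_uniq ?undup_uniq.
have [zpos z0] := zx b bP.
(* On [x *m M] the root [b] sees only the coefficients at [y]: it is nonnegative if [y] is in [S]
   and zero otherwise, and either property passes to [z]. *)
case: (boolP (y \in S)) => yS.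
  apply: cone_mem => //; rewrite -(pmulr_lge0 _ by_gt0) -bz.
  have : 0 <= '[b, x *m M].
    rewrite bx sumr_ge0 // => j _; rewrite mulr_ge0 //.
    by case: (eqVneq S`_j y) => [->|/(bS _ (ltn_ord j)) ->//]; apply: ltW.
  by rewrite le_eqVlt => /orP[/eqP/esym/z0->|/zpos].
have /z0/eqP : '[b, x *m M] = 0.
  rewrite bx big1 // => j _; rewrite bS ?mulr0 //.
  by apply: contraNneq yS => <-; rewrite mem_nth.
rewrite bz mulf_eq0 (gt_eqF by_gt0) orbF => /eqP ->; rewrite scale0r; exact: cone0.
Qed.

End ClusterFan.

Theorem theorem1p5 (R : realFieldType) (n : nat) (B : 'M[R]_n)
  (Phi : seq 'rV[R]_n) (alpha : 'I_n -> 'rV[R]_n) (Iplus : {set 'I_n})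
  (omega : 'I_n -> 'rV[R]_n) (M : 'M[R]_n) (comp : 'rV[R]_n -> 'rV[R]_n -> Prop) :
  inner_product B ->
  root_system B Phi ->
  simple_roots Phi alpha ->
  bipartition B alpha Iplus ->
  (forall i j, copair B (alpha i) (omega j) = (i == j)%:R) ->
  (forall i, alpha i *m M = eps R Iplus i *: omega i) ->
  compatibility B Phi alpha Iplus comp ->
  forall C : seq 'rV[R]_n, cluster Phi alpha comp C ->
  forall S : seq 'rV[R]_n, {subset S <= C} ->
  forall y : 'rV[R]_n, (exists x, cone S x /\ y = x *m M) ->
  exists y0 : 'rV[R]_n,
    cox_cone B Phi y0 y /\
    (forall z, cox_cone B Phi y0 z -> exists x, cone S x /\ z = x *m M).
Proof.
move=> ipB rootPhi simplePhi bipI omegaP actM hcomp C CC S SC y [x [xS ->]].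
(* Taking the point itself as base point selects the smallest Coxeter cone containing it. *)
exists (x *m M); split=> [b _|z zx]; first by split=> // /ltW.
exists (z *m invmx M); split; last by rewrite mulmxKV ?(M_unit ipB rootPhi simplePhi omegaP actM).
have CT := cluster_par_cluster ipB rootPhi simplePhi bipI omegaP actM hcomp CC.
have CD := par_cluster_dual ipB rootPhi simplePhi bipI omegaP actM CT.
exact: (cone_cox_cone ipB rootPhi simplePhi omegaP actM CD SC xS zx).
Qed.
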